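(* If a commuting $d$-tuple $\boldsymbol T=(T_1,\ldots,T_d)$ of bounded operators on a complex separable Hilbert space $\mathcal H$ is $d$-normal, then $\mathrm{dEt}\big([\![\boldsymbol T^*,\boldsymbol T]\!]\big)=0$.
   Context: $[A,B]:=AB-BA$, and $\mathfrak S_d$ is the permutation group on $d$ symbols. $[\![\boldsymbol T^*,\boldsymbol T]\!]$ is the $d\times d$ block operator with $(i,j)$ entry $B_{ij}=[T_j^*,T_i]$, and $$\mathrm{dEt}\big([\![\boldsymbol T^*,\boldsymbol T]\!]\big):=\sum_{\sigma,\tau\in\mathfrak S_d}\mathrm{Sgn}(\sigma)\,B_{\tau(1),\sigma(\tau(1))}B_{\tau(2),\sigma(\tau(2))}\cdots B_{\tau(d),\sigma(\tau(d))}.$$ A commuting $d$-tuple $\boldsymbol T=(T_1,\ldots,T_d)$ is $n$-normal if the operators $T_k$, $1\le k\le d$, belong to a $C^*$-algebra $\mathfrak A$ (of operators on $\mathcal H$) that is $*$-isometrically isomorphic to $C^*(\hat{\boldsymbol T})\otimes\mathcal M_n$ for some commuting $d$-tuple $\hat{\boldsymbol T}$ of normal operators, where $C^*(\hat{\boldsymbol T})$ is the (commutative) $C^*$-algebra generated by $\hat{\boldsymbol T}$ and $\mathcal M_n$ is the algebra of $n\times n$ complex matrices. *)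

(* Defs.v *)
From HB Require Import structures.
From mathcomp Require Import all_boot all_order all_algebra all_fingroup.
From mathcomp Require Import sesquilinear complex.
From mathcomp Require Import all_classical all_reals all_analysis.
From mathcomp Require Import ring lra.

Set Implicit Arguments.
Unset Strict Implicit.
Unset Printing Implicit Defensive.

Import Order.TTheory GRing.Theory Num.Theory.
Import numFieldNormedType.Exports.

Local Open Scope complex_scope.
Local Open Scope classical_set_scope.
Local Open Scope ring_scope.

HB.mixin Record CompleteNormedModule_isHilbert (R : realType) H
    & CompleteNormedModule R[i] H := {
  hdot : {dot H for @Num.conj R[i]} ;
  hnormE : forall x : H, `|x| ^+ 2 = hdot x x
}.

#[short(type="hilbertType")]
HB.structure Definition Hilbert (R : realType) :=
  { H of CompleteNormedModule R[i] H & CompleteNormedModule_isHilbert R H }.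

Section InnerProduct.
Variables (R : realType) (H : hilbertType R).
Implicit Types (x y z : H) (a : R[i]).
Local Notation "<[ x , y ]>" := (@hdot R H x y).

Lemma hdotC x y : <[x, y]> = Num.conj <[y, x]>.
Proof. by rewrite (hermC (@hdot R H)) expr0 mul1r. Qed.

Lemma hdotDl x y z : <[x + y, z]> = <[x, z]> + <[y, z]>.
Proof. by rewrite linearDl. Qed.

Lemma hdotDr x y z : <[x, y + z]> = <[x, y]> + <[x, z]>.
Proof. by rewrite linearDr. Qed.

Lemma hdotZl a x y : <[a *: x, y]> = a * <[x, y]>.
Proof. by rewrite linearZl_LR. Qed.

Lemma hdotZr a x y : <[x, a *: y]> = Num.conj a * <[x, y]>.
Proof. by rewrite linearZr_LR. Qed.

Lemma hdotNl x y : <[- x, y]> = - <[x, y]>.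
Proof. by rewrite linearNl. Qed.

Lemma hdotNr x y : <[x, - y]> = - <[x, y]>.
Proof. by rewrite linearNr. Qed.

Lemma hdotBr x y z : <[x, y - z]> = <[x, y]> - <[x, z]>.
Proof. by rewrite linearBr. Qed.

Lemma hdotBl x y z : <[x - y, z]> = <[x, z]> - <[y, z]>.
Proof. by rewrite linearBl. Qed.

Lemma hdot_injr y z : (forall x, <[x, y]> = <[x, z]>) -> y = z.
Proof.
move=> h; apply/subr0_eq/normr0_eq0/eqP.
by rewrite -sqrf_eq0 hnormE hdotBr h subrr.
Qed.

Lemma hdot_CS x y : `|<[x, y]>| <= `|x| * `|y|.
Proof.
have [->|y0] := eqVneq y 0.
  by rewrite linear0r !normr0 mulr0.
have n0 : 0 < `|y| by rewrite normr_gt0.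
rewrite -ler_sqr ?nnegrE ?mulr_ge0//.
have : 0 <= `|(`|y| ^+ 2) *: x - <[x, y]> *: y| ^+ 2 by rewrite exprn_ge0.
rewrite hnormE !(hdotBl, hdotBr, hdotZl, hdotZr) -!hnormE.
rewrite (hdotC y x) rmorphXn/= (CrealP (normr_real y)).
have -> : `|<[x, y]>| ^+ 2 = <[x, y]> * Num.conj <[x, y]> by rewrite normCK.
set a := <[x, y]>; set b := Num.conj a.
have -> : `|y| ^+ 2 * (`|y| ^+ 2 * `|x| ^+ 2) - `|y| ^+ 2 * (b * a) -
   (a * (`|y| ^+ 2 * b) - a * (b * `|y| ^+ 2)) =
   `|y| ^+ 2 * ((`|x| * `|y|) ^+ 2 - a * b) by ring.
by rewrite pmulr_rge0 ?exprn_gt0// subr_ge0.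
Qed.

End InnerProduct.

Section RealNorm.
Variables (R : realType) (V : normedModType R[i]).

Definition rnorm (x : V) : R := complex.Re `|x|.

Lemma rnormE x : (rnorm x)%:C = `|x|.
Proof. by rewrite RRe_real// normr_real. Qed.

Lemma rnorm_ge0 x : 0 <= rnorm x.
Proof. by rewrite -ler0c rnormE. Qed.

Lemma rnormD x y : rnorm (x + y) <= rnorm x + rnorm y.
Proof. by rewrite -lecR rmorphD/= !rnormE ler_normD. Qed.

Lemma rnormZ a x : rnorm (a *: x) = complex.Re `|a| * rnorm x.
Proof.
by apply: (@complexI R); rewrite rmorphM/= !rnormE normrZ.
Qed.

Lemma rnorm0 : rnorm 0 = 0.
Proof. by rewrite /rnorm normr0. Qed.

Lemma rnorm0_eq0 x : rnorm x = 0 -> x = 0.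
Proof. by move=> x0; apply/normr0_eq0; rewrite -rnormE x0. Qed.

End RealNorm.

Lemma rnorm2 (R : realType) (H : hilbertType R) (x : H) :
  (rnorm x ^+ 2)%:C = hdot x x.
Proof. by rewrite rmorphXn -hnormE -rnormE. Qed.

Section Riesz.
Variables (R : realType) (H : hilbertType R).
Variables (f : H -> R[i]) (M : R).
Hypothesis flin : linear_for *%R f.
Hypothesis fbnd : forall x, `|f x| <= (M * rnorm x)%:C.

Let fD x y : f (x + y) = f x + f y.
Proof. by have := flin 1 x y; rewrite scale1r mul1r. Qed.
Let f0 : f 0 = 0.
Proof. by have /eqP := fD 0 0; rewrite addr0 -subr_eq0 opprD addNKr oppr_eq0 => /eqP. Qed.
Let fZ a x : f (a *: x) = a * f x.
Proof. by have := flin a x 0; rewrite f0 !addr0. Qed.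

Let ReM x : `|complex.Re (f x)| <= M * rnorm x.
Proof. by rewrite -lecR (le_trans (normc_ge_Re _)). Qed.

Let J (x : H) : R := rnorm x ^+ 2 - 2 * complex.Re (f x).

Let Jlb x : - (M ^+ 2) <= J x.
Proof.
have := ReM x; rewrite ler_norml => /andP[_ h].
have := sqr_ge0 (rnorm x - M); rewrite /J; nra.
Qed.

Let m := inf (range J).

Let mlb x : m <= J x.
Proof.
apply: ge_inf; last by exists x.
by exists (- (M ^+ 2)) => _ [y _ <-].
Qed.

Let paral x y : rnorm (x - y) ^+ 2 <= 2 * J x + 2 * J y - 4 * m.
Proof.
have := mlb (2^-1 *: (x + y)).
rewrite /J fZ fD rnormZ.
have -> : complex.Re `|2^-1 : R[i]| = 2^-1 :> R.
  by rewrite ger0_norm ?invr_ge0// -[2]/(2%:R) -(rmorph_nat (real_complex R)) -fmorphV.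
have -> : complex.Re (2^-1 * (f x + f y)) = 2^-1 * (complex.Re (f x) + complex.Re (f y)).
  rewrite -[2 in X in complex.Re X]/(2%:R) -(rmorph_nat (real_complex R)) -fmorphV.
  by case: (f x) => ? ?; case: (f y) => ? ? /=; rewrite mul0r subr0.
have : rnorm (x - y) ^+ 2 + rnorm (x + y) ^+ 2 =
    2 * rnorm x ^+ 2 + 2 * rnorm y ^+ 2.
  apply: (@complexI R).
  rewrite (rmorphD (real_complex R)) (rmorphD (real_complex R)) /=.
  have two (r : R) : (2 * r)%:C = 2 * r%:C by rewrite rmorphM rmorph_nat.
  rewrite !two !rnorm2 !(hdotDl, hdotDr, hdotNl, hdotNr); ring.
nra.
Qed.

Lemma riesz : exists v : H, forall x, f x = hdot x v.
Proof.
have hasinf : has_inf (range J).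
  by split; [exists (J 0), 0 | exists (- (M ^+ 2)) => _ [y _ <-]].
have /choice[u uP] : forall n : nat, exists x, J x < m + n.+1%:R^-1.
  move=> n; have n0 : 0 < n.+1%:R^-1 :> R by rewrite invr_gt0.
  by have [_ [x _ <-] xm] := inf_adherent n0 hasinf; exists x.
have ucvg : cvg (u @ \oo).
  apply: cauchy_cvg; apply: cauchy_exP => e e0.
  have [r er] : exists r : R, e = r%:C by apply/complex_realP; rewrite gtr0_real.
  rewrite er in e0 *; rewrite ltcR in e0.
  have [n hn] : exists n, 4 * n.+1%:R^-1 < r ^+ 2 :> R.
    pose d := r ^+ 2 / 4.
    have d0 : 0 < d by rewrite divr_gt0// exprn_gt0.
    exists (Num.truncn d^-1).
    have := truncnS_gt d^-1.
    rewrite -ltf_pV2 ?posrE ?invr_gt0// invrK /d.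
    set q := _^-1 => h; lra.
  exists (u n); exists n => // k nk.
  rewrite -ball_normE /ball_/= -rnormE ltcR.
  rewrite -ltr_sqr ?nnegrE ?rnorm_ge0 ?(ltW e0)//.
  apply: le_lt_trans (paral _ _) _; apply: lt_trans hn.
  have := uP n; have := uP k.
  have : k.+1%:R^-1 <= n.+1%:R^-1 :> R.
    by rewrite lef_pV2 ?posrE// ler_nat.
  by move: (n.+1%:R^-1) (k.+1%:R^-1) => p q; lra.
pose v := lim (u @ \oo).
have Jv : J v <= m.
  apply/ler_addgt0Pr => e e0.
  pose k := 2 * rnorm v + 1 + 2 * `|M|.
  have k0 : 0 < k.
    by rewrite /k; have := rnorm_ge0 v; have := normr_ge0 M; lra.
  pose d := Num.min 1 (e / 2 / k).
  have d0 : 0 < d by rewrite lt_min ltr01/= !divr_gt0.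
  have /cvgrPdist_lt/(_ d%:C) : u @ \oo --> v by [].
  rewrite ltcR => /(_ d0)[N _ hN].
  pose N1 := Num.truncn (e / 2)^-1.
  have /hN := leq_maxl N N1; set n := maxn N N1 => /=.
  rewrite -rnormE ltcR => dn.
  have Jn : J (u n) < m + e / 2.
    apply: lt_trans (uP n) _; rewrite ltrD2l.
    rewrite -[ltRHS]invrK ltf_pV2 ?posrE ?invr_gt0 ?divr_gt0//.
    apply: lt_le_trans (truncnS_gt _) _.
    by rewrite ler_nat ltnS leq_maxr.
  have fuv : f v = f (u n) + f (v - u n) by rewrite -fD addrC subrK.
  have nuv : rnorm v <= rnorm (u n) + rnorm (v - u n).
    by apply: le_trans (rnormD _ _); rewrite addrC subrK.
  have nvu : rnorm (u n) <= rnorm v + rnorm (v - u n).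
    apply: le_trans (_ : _ <= rnorm v + rnorm (u n - v)) _.
      by apply: le_trans (rnormD _ _); rewrite addrC subrK.
    by rewrite /rnorm distrC.
  have := ReM (v - u n); rewrite ler_norml => /andP[h _].
  have d1 : d <= 1 by rewrite ge_min lexx.
  have d2 : d * k <= e / 2.
    by rewrite -ler_pdivlMr// ge_min lexx orbT.
  have Mle := ler_norm M.
  have w0 := rnorm_ge0 (v - u n); have v0 := rnorm_ge0 v.
  have un0 := rnorm_ge0 (u n).
  have RD : complex.Re (f v) = complex.Re (f (u n)) + complex.Re (f (v - u n)).
    by rewrite fuv; case: (f _); case: (f _).
  have a1 : rnorm v ^+ 2 - rnorm (u n) ^+ 2 <=
    rnorm (v - u n) * (2 * rnorm v + 1).
    have : rnorm v ^+ 2 - rnorm (u n) ^+ 2 =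
     (rnorm v - rnorm (u n)) * (rnorm v + rnorm (u n)) by ring.
    move=> ->.
    apply: le_trans (_ : rnorm (v - u n) * (rnorm v + rnorm (u n)) <= _).
      by apply: ler_wpM2r; lra.
    apply: ler_wpM2l => //; lra.
  have a2 : M * rnorm (v - u n) <= `|M| * rnorm (v - u n) by exact: ler_wpM2r.
  have a3 : rnorm (v - u n) * k <= e / 2.
    by apply: le_trans d2; apply: ler_wpM2r; exact: ltW.
  have : J v <= J (u n) + rnorm (v - u n) * k.
    rewrite /J RD /k; lra.
  lra.
exists v => w; apply/subr0_eq.
set g := _ - _.
have gE : f w = g + hdot w v by rewrite /g subrK.
clearbody g.
apply/normr0_eq0/eqP; rewrite -sqrf_eq0.
pose s : R := complex.Re (`|g|).
have sE : s%:C = `|g| by rewrite RRe_real ?normr_real.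
pose t : R := (rnorm w ^+ 2 + 1)^-1.
have t0 : 0 < t by rewrite invr_gt0 ltr_wpDl// sqr_ge0.
have := mlb (v + (t%:C * Num.conj g) *: w).
have -> : J (v + (t%:C * Num.conj g) *: w) =
   J v + t ^+ 2 * s ^+ 2 * rnorm w ^+ 2 - 2 * t * s ^+ 2.
  apply: (@complexI R); rewrite /J.
  set c := t%:C * _.
  have ReE (z : R[i]) : (2 * complex.Re z)%:C = z + Num.conj z.
    by rewrite addcJ rmorphM rmorph_nat.
  rewrite (rmorphB (real_complex R)) [RHS](rmorphB (real_complex R)).
  rewrite (rmorphD (real_complex R)) (rmorphB (real_complex R)) /=.
  have mulE (p q : R) : (p * q)%:C = p%:C * q%:C by rewrite rmorphM.
  have sqE (p : R) : (p ^+ 2)%:C = p%:C ^+ 2 by rewrite rmorphXn.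
  have twoE : (2 : R)%:C = 2 by rewrite rmorph_nat.
  rewrite !ReE !rnorm2 (mulE (t ^+ 2 * _)) rnorm2 (mulE (t ^+ 2)).
  rewrite (mulE (2 * t)) (mulE 2) !sqE sE normCK twoE.
  rewrite fD fZ !rmorphD !(hdotDl, hdotDr, hdotZl, hdotZr) (hdotC v w).
  rewrite gE /c !(rmorphM, rmorphD)/= conjCK.
  have -> : Num.conj t%:C = t%:C :> R[i] by apply/CrealP; rewrite complex_real.
  ring.
move=> h.
have tw : t * rnorm w ^+ 2 <= 1.
  by rewrite /t mulrC ler_pdivrMr ?mul1r ?lerDl// ltr_wpDl// sqr_ge0.
have : 0 <= t * (s ^+ 2 * (t * rnorm w ^+ 2 - 2)) by lra.
rewrite pmulr_rge0// => h2.
have : s ^+ 2 <= 0.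
  have := sqr_ge0 s; nra.
rewrite le_eqVlt ltNge sqr_ge0 orbF => /eqP s0.
by rewrite -sE -rmorphXn /= s0.
Qed.

End Riesz.

Record bop (R : realType) (H : hilbertType R) := Bop {
  bop_fun :> H -> H ;
  bop_linear : linear bop_fun ;
  bop_bounded : exists M : R, forall x, rnorm (bop_fun x) <= M * rnorm x
}.

Section BoundedOperators.
Variables (R : realType) (H : hilbertType R).
Implicit Types S T U : bop H.

HB.instance Definition _ T :=
  GRing.isLinear.Build R[i] H H _ (bop_fun T) (@bop_linear _ _ T).

Lemma bopP S T : S =1 T -> S = T.
Proof.
case: S T => [f fl fb] [g gl gb] /= /funext fg; subst g.
by rewrite (Prop_irrelevance fl gl) (Prop_irrelevance fb gb).
Qed.

HB.instance Definition _ := gen_eqMixin (bop H).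
HB.instance Definition _ := gen_choiceMixin (bop H).

Lemma bop_bndP T : exists2 M, 0 <= M & forall x, rnorm (T x) <= M * rnorm x.
Proof.
have [M hM] := bop_bounded T; exists `|M| => // x.
apply: le_trans (hM x) _; apply: ler_wpM2r; first exact: rnorm_ge0.
exact: ler_norm.
Qed.

Program Definition bop_zero : bop H := @Bop R H (fun=> 0) _ _.
Next Obligation. by move=> a x y; rewrite scaler0 addr0. Qed.
Next Obligation. by exists 0 => x; rewrite rnorm0 mul0r. Qed.

Program Definition bop_opp T : bop H := @Bop R H (fun x => - T x) _ _.
Next Obligation. by move=> T a x y; rewrite linearP opprD scalerN. Qed.
Next Obligation.
move=> T; have [M hM] := bop_bounded T; exists M => x.
by rewrite /rnorm normrN; exact: hM.
Qed.

Program Definition bop_add S T : bop H := @Bop R H (fun x => S x + T x) _ _.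
Next Obligation. by move=> S T a x y; rewrite !linearP scalerDr addrACA. Qed.
Next Obligation.
move=> S T; have [M hM] := bop_bounded S; have [N hN] := bop_bounded T.
exists (M + N) => x; apply: le_trans (rnormD _ _) _.
by rewrite mulrDl lerD.
Qed.

Program Definition bop_scale (a : R[i]) T : bop H :=
  @Bop R H (fun x => a *: T x) _ _.
Next Obligation.
by move=> a T b x y; rewrite linearP scalerDr !scalerA mulrC.
Qed.
Next Obligation.
move=> a T; have [M hM] := bop_bounded T.
exists (complex.Re `|a| * M) => x; rewrite rnormZ -mulrA.
by apply: ler_wpM2l => //; rewrite -ler0c RRe_real ?normr_real.
Qed.

Program Definition bop_one : bop H := @Bop R H id _ _.
Next Obligation. by []. Qed.
Next Obligation. by exists 1 => x; rewrite mul1r. Qed.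

Program Definition bop_mul S T : bop H := @Bop R H (fun x => S (T x)) _ _.
Next Obligation. by move=> S T a x y; rewrite !linearP. Qed.
Next Obligation.
move=> S T; have [M M0 hM] := bop_bndP S; have [N hN] := bop_bounded T.
exists (M * N) => x; apply: le_trans (hM _) _.
by rewrite -mulrA ler_wpM2l.
Qed.

Fact bop_addA : associative bop_add.
Proof. by move=> S T U; apply: bopP => x /=; rewrite addrA. Qed.
Fact bop_addC : commutative bop_add.
Proof. by move=> S T; apply: bopP => x /=; rewrite addrC. Qed.
Fact bop_add0 : left_id bop_zero bop_add.
Proof. by move=> S; apply: bopP => x /=; rewrite add0r. Qed.
Fact bop_addN : left_inverse bop_zero bop_opp bop_add.
Proof. by move=> S; apply: bopP => x /=; rewrite addNr. Qed.
HB.instance Definition _ := GRing.isZmodule.Build (bop H)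
  bop_addA bop_addC bop_add0 bop_addN.

Fact bop_mulA : associative bop_mul.
Proof. by move=> S T U; apply: bopP. Qed.
Fact bop_mul1 : left_id bop_one bop_mul.
Proof. by move=> S; apply: bopP. Qed.
Fact bop_1mul : right_id bop_one bop_mul.
Proof. by move=> S; apply: bopP. Qed.
Fact bop_mulDl : left_distributive bop_mul +%R.
Proof. by move=> S T U; apply: bopP. Qed.
Fact bop_mulDr : right_distributive bop_mul +%R.
Proof. by move=> S T U; apply: bopP => x /=; rewrite linearD. Qed.
HB.instance Definition _ := GRing.Zmodule_isPzRing.Build (bop H)
  bop_mulA bop_mul1 bop_1mul bop_mulDl bop_mulDr.

Fact bop_scaleA a b T : bop_scale a (bop_scale b T) = bop_scale (a * b) T.
Proof. by apply: bopP => x /=; rewrite scalerA. Qed.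
Fact bop_scale1 : left_id 1 bop_scale.
Proof. by move=> S; apply: bopP => x /=; rewrite scale1r. Qed.
Fact bop_scaleDr : right_distributive bop_scale +%R.
Proof. by move=> a S T; apply: bopP => x /=; rewrite scalerDr. Qed.
Fact bop_scaleDl T : {morph bop_scale^~ T : a b / a + b}.
Proof. by move=> a b; apply: bopP => x /=; rewrite scalerDl. Qed.
HB.instance Definition _ := GRing.Zmodule_isLmodule.Build R[i] (bop H)
  bop_scaleA bop_scale1 bop_scaleDr bop_scaleDl.

Lemma bop0E x : (0 : bop H) x = 0. Proof. by []. Qed.
Lemma bop1E x : (1 : bop H) x = x. Proof. by []. Qed.
Lemma bopDE S T x : (S + T) x = S x + T x. Proof. by []. Qed.
Lemma bopNE T x : (- T) x = - T x. Proof. by []. Qed.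
Lemma bopME S T x : (S * T) x = S (T x). Proof. by []. Qed.
Lemma bopZE a T x : (a *: T) x = a *: T x. Proof. by []. Qed.

Definition opnorm T : R := sup [set rnorm (T x) | x in [set x | rnorm x <= 1]].

Lemma opnorm_has_sup T :
  has_sup [set rnorm (T x) | x in [set x | rnorm x <= 1]].
Proof.
split; first by exists (rnorm (T 0)), 0 => //=; rewrite rnorm0.
have [M M0 hM] := bop_bndP T; exists M => _ [x /= x1 <-].
by apply: le_trans (hM x) _; rewrite ler_piMr.
Qed.

Lemma opnorm_le T (M : R) :
  (forall x, rnorm x <= 1 -> rnorm (T x) <= M) -> opnorm T <= M.
Proof.
move=> h; apply: ge_sup; first by case: (opnorm_has_sup T).
by move=> _ [x /= x1 <-]; exact: h.
Qed.

Lemma le_opnorm T x : rnorm (T x) <= opnorm T * rnorm x.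
Proof.
have [->|x0] := eqVneq x 0; first by rewrite linear0 !rnorm0 mulr0.
have n0 : 0 < rnorm x.
  rewrite lt_def rnorm_ge0 andbT; apply: contra x0 => /eqP.
  by move/rnorm0_eq0 => ->.
rewrite -ler_pdivrMr// mulrC.
have nE : complex.Re `|(rnorm x)^-1%:C| = (rnorm x)^-1 :> R.
  by rewrite ger0_norm// ler0c invr_ge0 ltW.
have -> : (rnorm x)^-1 * rnorm (T x) = rnorm (T ((rnorm x)^-1%:C *: x)).
  by rewrite linearZ rnormZ nE.
apply: ub_le_sup; first by case: (opnorm_has_sup T).
by exists ((rnorm x)^-1%:C *: x) => //=; rewrite rnormZ nE mulVf// gt_eqF.
Qed.

Lemma opnorm_ge0 T : 0 <= opnorm T.
Proof.
apply: le_trans (rnorm_ge0 (T 0)) _.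
by apply: ub_le_sup; [case: (opnorm_has_sup T)|exists 0 => //=; rewrite rnorm0].
Qed.

Definition bop_norm T : R[i] := (opnorm T)%:C.

Fact bop_normD S T : bop_norm (S + T) <= bop_norm S + bop_norm T.
Proof.
rewrite /bop_norm -rmorphD lecR; apply: opnorm_le => x x1.
apply: le_trans (rnormD _ _) _.
by apply: lerD; apply: le_trans (le_opnorm _ _) _; rewrite ler_piMr// opnorm_ge0.
Qed.

Fact bop_normZ a T : bop_norm (a *: T) = `|a| * bop_norm T.
Proof.
rewrite /bop_norm -[`|a|]RRe_real ?normr_real// -rmorphM; congr (_%:C).
set r := complex.Re _.
have rE : r = complex.Re `|a| by [].
have [a0|a0] := eqVneq a 0.
  rewrite rE a0 normr0 mul0r; apply/eqP; rewrite eq_le opnorm_ge0 andbT.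
  by apply: opnorm_le => x _; rewrite bopZE scale0r rnorm0.
have r0 : 0 < r by rewrite -ltcR rE RRe_real ?normr_real// normr_gt0.
apply/eqP; rewrite eq_le; apply/andP; split.
  apply: opnorm_le => x x1; rewrite bopZE rnormZ ler_wpM2l ?(ltW r0)//.
  by apply: le_trans (le_opnorm _ _) _; rewrite ler_piMr// opnorm_ge0.
rewrite mulrC -ler_pdivlMr//; apply: opnorm_le => x x1.
rewrite ler_pdivlMr// mulrC.
have -> : r * rnorm (T x) = rnorm ((a *: T) x) by rewrite bopZE rnormZ.
by apply: le_trans (le_opnorm _ _) _; rewrite ler_piMr// opnorm_ge0.
Qed.

Fact bop_norm0_eq0 T : bop_norm T = 0 -> T = 0.
Proof.
move=> /(@complexI R) T0; apply: bopP => x; apply: rnorm0_eq0; apply/eqP.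
by rewrite eq_le rnorm_ge0 andbT (le_trans (le_opnorm _ _))// T0 mul0r.
Qed.

HB.instance Definition _ := @Lmodule_isNormed.Build R[i] (bop H)
  bop_norm bop_normD bop_normZ bop_norm0_eq0.

Lemma adj_exists T : exists S, forall x y, hdot (T x) y = hdot x (S y).
Proof.
have [M M0 hM] := bop_bndP T.
have /choice[s sP] : forall y, exists v, forall x, hdot (T x) y = hdot x v.
  move=> y; apply: (@riesz R H (fun x => hdot (T x) y) (M * rnorm y)) => [a x z|x].
    by rewrite linearP hdotDl hdotZl.
  apply: le_trans (hdot_CS _ _) _; rewrite -!rnormE -rmorphM lecR.
  by rewrite mulrAC ler_wpM2r ?rnorm_ge0.
have sl : linear s.
  move=> a y z; apply: hdot_injr => x.
  by rewrite -sP !hdotDr !hdotZr !sP.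
have sb : exists N : R, forall x, rnorm (s x) <= N * rnorm x.
  exists M => y; have [->|s0] := eqVneq (rnorm (s y)) 0.
    by rewrite mulr_ge0 ?rnorm_ge0.
  have s1 : 0 < rnorm (s y) by rewrite lt_def s0 rnorm_ge0.
  rewrite -(ler_pM2r s1) -expr2 -lecR rnorm2 -sP.
  have := hdot_CS (T (s y)) y.
  rewrite -!rnormE -rmorphM => h.
  apply: le_trans (_ : `|hdot (T (s y)) y| <= _).
    by apply: real_ler_norm; rewrite sP -rnorm2 complex_real.
  apply: le_trans h _; rewrite lecR mulrAC ler_wpM2r ?rnorm_ge0//.
by exists (Bop sl sb).
Qed.

Definition adj T : bop H := projT1 (cid (adj_exists T)).

Lemma adjP T x y : hdot (T x) y = hdot x (adj T y).
Proof. by rewrite /adj; case: (cid _). Qed.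

End BoundedOperators.

Definition commuting (d : nat) (A : pzRingType) (T : 'I_d -> A) :=
  forall i j, T i * T j = T j * T i.

(* Norm-closed *-subalgebras of B(H), not required to contain the identity. *)
Definition cstar_algebra (R : realType) (H : hilbertType R) (A : set (bop H)) :=
  [/\ A 0,
      (forall S T, A S -> A T -> A (S + T)),
      (forall a S, A S -> A (a *: S)),
      (forall S T, A S -> A T -> A (S * T)) &
      (forall S, A S -> A (adj S))] /\ closed A.

Definition cstar_gen (R : realType) (H : hilbertType R) (d : nat)
  (T : 'I_d -> bop H) : set (bop H) := smallest (@cstar_algebra R H) (range T).

(* Operators on K (x) C^n = K^n are written as n x n block matrices over B(K);
   a (x) m has (i, j) block m i j *: a.  Since M_n is finite dimensional, the
   algebraic tensor product of a C*-algebra with M_n is already complete. *)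
Definition elem_tensor (R : realType) (K : hilbertType R) (n : nat)
  (a : bop K) (m : 'M[R[i]]_n) : 'M[bop K]_n := \matrix_(i, j) (m i j *: a).

Definition tensor_mx (R : realType) (K : hilbertType R) (n : nat)
    (A : set (bop K)) : set 'M[bop K]_n :=
  [set X | exists (r : nat) (a : 'I_r -> bop K) (m : 'I_r -> 'M[R[i]]_n),
     (forall k, A (a k)) /\ X = \sum_(k < r) elem_tensor (a k) (m k)].

Arguments tensor_mx {R K} n A _.

Definition mxadj (R : realType) (K : hilbertType R) (n : nat)
  (X : 'M[bop K]_n) : 'M[bop K]_n := map_mx (@adj R K) X^T.

(* Norm of the operator that the block matrix X induces on the Hilbert direct
   sum K^n; the library's own norm on matrices is the entrywise maximum. *)
Definition mxopnorm (R : realType) (K : hilbertType R) (n : nat)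
    (X : 'M[bop K]_n) : R :=
  sup [set Num.sqrt (\sum_i rnorm (\sum_j X i j (x j)) ^+ 2) |
       x in [set x : 'I_n -> K | \sum_j rnorm (x j) ^+ 2 <= 1]].

Definition star_isometric_iso (R : realType) (H K : hilbertType R) (n : nat)
    (A : set (bop H)) (B : set 'M[bop K]_n) (phi : bop H -> 'M[bop K]_n) :=
  [/\ set_bij A B phi,
      (forall a S T, A S -> A T -> phi (a *: S + T) =
         map_mx ( *:%R a) (phi S) + phi T),
      (forall S T, A S -> A T -> phi (S * T) = phi S *m phi T),
      (forall S, A S -> phi (adj S) = mxadj (phi S)) &
      (forall S, A S -> opnorm S = mxopnorm (phi S))].

Definition n_normal (R : realType) (H : hilbertType R) (n d : nat)
    (T : 'I_d -> bop H) :=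
  commuting T /\
  exists (A : set (bop H)) (K : hilbertType R) (That : 'I_d -> bop K),
    [/\ cstar_algebra A,
        forall k, A (T k),
        commuting That,
        forall k, That k * adj (That k) = adj (That k) * That k &
        exists phi, star_isometric_iso A (tensor_mx n (cstar_gen That)) phi].

Definition commutator (A : pzRingType) (a b : A) := a * b - b * a.

Definition self_commutator_mx (R : realType) (H : hilbertType R) (d : nat)
    (T : 'I_d -> bop H) : 'M[bop H]_d :=
  \matrix_(i, j) commutator (adj (T j)) (T i).

Definition dEt (A : pzRingType) (d : nat) (B : 'M[A]_d) : A :=
  \sum_(s : 'S_d) \sum_(t : 'S_d)
     (-1) ^+ s * \prod_(i < d) B (t i) (s (t i)).

Definition separable (X : topologicalType) :=
  exists2 D : set X, countable D & dense D.

(* Main.v *)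
From HB Require Import structures.
From mathcomp Require Import all_boot all_order all_algebra.
From mathcomp Require Import all_fingroup cyclic separable cyclotomic complex.
From mathcomp Require Import all_classical all_reals all_analysis.
From mathcomp Require Import ring lra zify.
Require Import Defs.

Set Implicit Arguments.
Unset Strict Implicit.
Unset Printing Implicit Defensive.

Import Order.TTheory GRing.Theory Num.Theory.
Import numFieldNormedType.Exports.

Local Open Scope complex_scope.
Local Open Scope classical_set_scope.
Local Open Scope ring_scope.

(** Introduce anticommuting variables theta_1, ..., theta_d, eta_1, ..., eta_d
    and the formal sums A = sum_i T_i theta_i and A' = sum_j T_j^* eta_j.  Since
    the T_i commute and the theta_i anticommute, A A = 0, and likewise A' A' = 0;
    therefore
      (A + A')^2 = A' A + A A' = sum_(i,j) [T_j^*, T_i] eta_j theta_i.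
    The elements eta_j theta_i commute with one another, and their product over
    the pairs (tau(k), sigma(tau(k))) is Sgn(sigma) times the top form, so
      (A + A')^(2d) = dEt [[T^*, T]] * (eta_1 theta_1) ... (eta_d theta_d).
    When T is d-normal, the T_i and T_j^* may be replaced by d x d matrices over
    a commutative algebra C, and X = A + A' becomes a d x d matrix with pairwise
    anticommuting entries.  For such a matrix X^(2d) = 0, which is Rosset's
    argument for the Amitsur-Levitzki theorem: the entries of X^2 commute with
    one another, anticommutation makes every trace tr (X^(2k)) equal to its own
    opposite, and over a torsion-free commutative ring a d x d matrix all of
    whose powers have trace zero has a vanishing d-th power.  The top form can
    be cancelled, so dEt [[T^*, T]] = 0.  The matrix form of this argument is
    dEt_commuting_matrices.

    The commutativity of C, the C*-algebra generated by commuting normal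
    operators N_1, ..., N_d, is not formal: it rests on Fuglede's theorem, that
    an operator commuting with a normal operator N commutes with N^*, proved here
    as a discrete form of the classical argument by Liouville's theorem.  Write
    D Y = N^* Y - Y N^*.  On the commutant of N, for every complex t, the
    operator D satisfies |Y + t D Y| <= (1 + c |t|^2) |Y|, because t D is also
    the commutator with the skew-adjoint operator t N^* - conj(t) N.  Applying
    1 + (w/n) D exactly n^2 times to X, with |w| = 1, gives a polynomial in w
    which is bounded independently of n and whose coefficient of degree one is
    n D X; a Cauchy estimate bounds n |D X| for all n, and so D X = 0. *)

(** * Matrices all of whose powers have trace zero *)

Definition torsion_free (V : zmodType) :=
  forall (x : V) (k : nat), x *+ k.+1 = 0 -> x = 0.

Section TraceNilpotent.
Variables (S : comNzRingType).

Lemma deriv_prod_seq (I : eqType) (r : seq I) (F : I -> {poly S}) :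
  uniq r ->
  (\prod_(i <- r) F i)^`() =
    \sum_(i <- r) (F i)^`() * \prod_(j <- r | j != i) F j.
Proof.
elim: r => [|a r IHr] /=; first by rewrite !big_nil derivC.
case/andP=> ar ur; rewrite big_cons derivM IHr // big_cons; congr (_ * _ + _).
  rewrite big_cons eqxx /= big_seq [RHS]big_seq_cond; apply: eq_bigl => j.
  by case: (boolP (j \in r)) => //= jr; rewrite (memPn ar).
rewrite mulr_sumr; apply: eq_big_seq => j jr.
by rewrite big_cons eq_sym (memPn ar) //= mulrCA.
Qed.

(** Jacobi's formula: differentiating one factor of the Leibniz expansion of
    det (X - Y) at a time, the i-th factor contributes only through its diagonal
    entry, and what it leaves is the (i, i) cofactor. *)
Lemma deriv_char_poly n (Y : 'M[S]_n) :
  (char_poly Y)^`() = \tr (\adj (char_poly_mx Y)).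
Proof.
rewrite /char_poly /determinant raddf_sum /=.
have dY i j : (char_poly_mx Y i j)^`() = (i == j)%:R.
  by rewrite !mxE derivB derivC subr0 derivMn derivX.
have dsign (b : bool) (p : {poly S}) : ((-1) ^+ b * p)^`() = (-1) ^+ b * p^`().
  by rewrite !mulr_sign; case: b; rewrite ?derivN.
under eq_bigr => s _.
  rewrite dsign deriv_prod_seq ?index_enum_uniq // mulr_sumr.
  over.
rewrite exchange_big /=; apply: eq_bigr => i _.
rewrite mxE expand_cofactor [RHS]big_mkcond; apply: eq_bigr => s _.
rewrite dY eq_sym; case: ifP => _; last by rewrite mul0r mulr0.
rewrite mul1r; congr (_ * _).
by apply: eq_bigl => k; rewrite eq_sym.
Qed.

(** The Faddeev-LeVerrier recursion.  Let N_j be the coefficient of X^j in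
    adj (X - Y) and c_j that of the characteristic polynomial.  Then
    N_j = Y N_(j+1) + c_(j+1), while Jacobi's formula gives
    tr N_j = (j+1) c_(j+1).  Going down from N_(n-1) = 1, as long as
    N_(j+1) = Y^(n-j-2) the trace of the recursion reads
    (j+1) c_(j+1) = n c_(j+1), so c_j = 0 for 0 < j < n.  In degree 0 the
    adjugate identity becomes Y^n = - c_0, whose trace gives c_0 = 0. *)
Lemma trace_nilpotent n (Y : 'M[S]_n) : torsion_free S ->
  (forall k, \tr (Y ^+ k.+1) = 0) -> Y ^+ n = 0.
Proof.
move=> tf trY.
have [n0|n_gt0] := posnP n.
  by apply/matrixP => i; have := ltn_ord i; rewrite {2}n0.
pose N j := map_mx (coefp j) (\adj (char_poly_mx Y)).
pose c := char_poly Y.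
set D := \adj (char_poly_mx Y) in N *.
have adjE a b : 'X * D a b - \sum_k (Y a k)%:P * D k b = c *+ (a == b).
  have /matrixP/(_ a b) := mul_mx_adj (char_poly_mx Y).
  rewrite -/D {1}/char_poly_mx mulmxBl mul_scalar_mx [RHS]mxE => <-.
  rewrite [RHS]mxE [X in _ = X + _]mxE; congr (_ + _).
  rewrite [RHS]mxE; congr (- _); rewrite [RHS]mxE.
  by apply: eq_bigr => k _; congr (_ * _); rewrite mxE.
have NE j : N j = Y *m N j.+1 + (c`_j.+1)%:M.
  apply/matrixP => a b.
  have := congr1 (fun p : {poly S} => p`_j.+1) (adjE a b).
  rewrite coefB coefXM /= coef_sum coefMn => /eqP.
  rewrite subr_eq addrC => /eqP h.
  rewrite [LHS]mxE /= h [RHS]mxE; congr (_ + _); rewrite mxE //.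
  by apply: eq_bigr => k _; rewrite [in RHS]mxE coefCM.
have NE0 : Y *m N 0 = - (c`_0)%:M.
  apply/matrixP => a b.
  have := congr1 (fun p : {poly S} => p`_0) (adjE a b).
  rewrite coefB coefXM /= sub0r coef_sum coefMn => h.
  rewrite mxE [in RHS]mxE mxE -h opprK.
  by apply: eq_bigr => k _; rewrite [in LHS]mxE coefCM.
have c_big j : (n < j)%N -> c`_j = 0.
  by move=> nj; rewrite nth_default // size_char_poly.
have c_n : c`_n = 1.
  by have /monicP := char_poly_monic Y; rewrite lead_coefE size_char_poly.
have trN j : \tr (N j) = c`_j.+1 *+ j.+1.
  by rewrite -coef_deriv deriv_char_poly coef_sum; apply: eq_bigr => i _; rewrite [LHS]mxE.
have [B NB] : exists B, forall j, (B <= j)%N -> N j = 0.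
  (* The recursion runs downwards: it starts beyond the degrees of all the
     entries of the adjugate. *)
  exists (\max_i \max_k size (D i k)) => j Bj.
  apply/matrixP => i k; rewrite [LHS]mxE [RHS]mxE /= nth_default //.
  apply: leq_trans Bj.
  apply: leq_trans (leq_bigmax (F := fun k => size (D i k)) k) _.
  exact: (leq_bigmax (F := fun i => \max_k size (D i k))).
have N_big j : (n <= j)%N -> N j = 0.
  move=> nj; have {}NB : N (j + B)%N = 0 by apply: NB; rewrite leq_addl.
  elim: B NB => [|k IHk] NB; first by rewrite addn0 in NB.
  apply: IHk; rewrite NE; rewrite addnS in NB; rewrite NB mulmx0 c_big ?raddf0 ?addr0 //.
  by rewrite ltnS (leq_trans nj) ?leq_addr.
have trS (x : S) : \tr (x%:M : 'M[S]_n) = x *+ n by exact: mxtrace_scalar.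
have NY k : (k < n)%N -> N (n - k.+1)%N = Y ^+ k.
  elim: k => [|k IHk] kn.
    by rewrite NE subn1 prednK // c_n N_big ?mulmx0 ?add0r.
  set i := (n - k.+2)%N.
  have iE : i.+1 = (n - k.+1)%N by rewrite /i subnSK.
  have NiE : N i = Y ^+ k.+1 + (c`_i.+1)%:M by rewrite NE iE IHk ?(ltnW kn) // exprS.
  have := trN i; rewrite NiE raddfD /= trY add0r trS => ci.
  rewrite (_ : c`_i.+1 = 0) ?raddf0 ?addr0 //.
  apply: (tf _ k); apply/eqP.
  by rewrite -(subKn (ltnW kn)) -iE mulrnBr ?ci ?subrr // iE leq_subr.
have YE : Y ^+ n = - (c`_0)%:M.
  have N0 : N 0%N = Y ^+ n.-1 by rewrite -NY prednK // subnn.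
  have -> : Y ^+ n = Y * Y ^+ n.-1 by rewrite -exprS prednK.
  by rewrite -NE0 N0.
have trYn : \tr (Y ^+ n) = 0 by have := trY n.-1; rewrite prednK.
move: trYn; rewrite YE raddfN /= trS => /eqP.
by rewrite oppr_eq0 -(prednK n_gt0) => /eqP/tf ->; rewrite raddf0 oppr0.
Qed.
End TraceNilpotent.

(** * Commuting families in a noncommutative ring *)

Section Bicommutant.
Variables (E : nzRingType) (I : Type) (y : I -> E).
Hypothesis ycomm : forall i j, y i * y j = y j * y i.

(** Everything commuting with the centralizer of a commuting family is a
    commutative subring containing the family: the y_i lie in their own
    centralizer, hence an element of the bicommutant commutes with each y_i, so
    it lies in the centralizer too. *)
Definition bicommutant : {pred E} := [pred x |
  `[< forall w, (forall i, w * y i = y i * w) -> w * x = x * w >]].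

Lemma bicommutantP x :
  reflect (forall w, (forall i, w * y i = y i * w) -> w * x = x * w)
          (x \in bicommutant).
Proof. exact: asboolP. Qed.

Fact bicommutant_subring : subring_closed bicommutant.
Proof.
split=> [|a b /bicommutantP ca /bicommutantP cb|a b /bicommutantP ca /bicommutantP cb];
  apply/bicommutantP => w cw.
- by rewrite mulr1 mul1r.
- by rewrite mulrBr mulrBl ca // cb.
- by rewrite mulrA ca // -mulrA cb // mulrA.
Qed.
HB.instance Definition _ :=
  GRing.isSubringClosed.Build E bicommutant bicommutant_subring.

Record bicomm_sub := BicommSub { bicomm_val : E; _ : bicomm_val \in bicommutant }.
HB.instance Definition _ := [isSub for bicomm_val].
HB.instance Definition _ := [Choice of bicomm_sub by <:].
HB.instance Definition _ := [SubChoice_isSubNzRing of bicomm_sub by <:].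

Lemma mem_bicommutant i : y i \in bicommutant.
Proof. by apply/bicommutantP => w ->. Qed.

Fact bicomm_mulC : commutative (@GRing.mul bicomm_sub).
Proof.
move=> u v; apply: val_inj; rewrite !rmorphM /=.
have /bicommutantP := valP v; apply => i.
by apply/esym; have /bicommutantP := valP u; apply.
Qed.
End Bicommutant.

(** Determinants and characteristic polynomials live over commutative rings;
    this lets them be applied to matrices whose entries merely commute. *)
Lemma commuting_family_lift (E : nzRingType) (I : Type) (y : I -> E) :
  (forall i j, y i * y j = y j * y i) ->
  exists (S : comNzRingType) (f : {rmorphism S -> E}) (z : I -> S),
    injective f /\ forall i, f (z i) = y i.
Proof.
move=> ycomm.
pose S : comNzRingType := HB.pack (bicomm_sub y)
  (GRing.PzRing_hasCommutativeMul.Build (bicomm_sub y) (bicomm_mulC ycomm)).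
exists S, (\val : {rmorphism bicomm_sub y -> E}), (fun i => BicommSub (mem_bicommutant y i)).
by split => //; exact: val_inj.
Qed.

(** * Matrices with anticommuting entries *)

Section Anticommuting.
Variables (E : nzRingType) (n : nat) (X : 'M[E]_n).
Hypothesis tfE : torsion_free E.
Hypothesis X_anti : forall a b c d, X a b * X c d = - (X c d * X a b).

(** Rosset's argument.  With Y = X^2 and W = X Y^k, the entries of W anticommute
    with those of X because the entries of Y commute with them, so
    tr (X W) = - tr (W X); but X W = W X = Y^(k+1), and 2 can be cancelled. *)
Lemma anticomm_mx_nilpotent : (X *m X) ^+ n = 0.
Proof.
pose Y := X *m X.
have XY a b c d : X a b * Y c d = Y c d * X a b.
  rewrite mxE mulr_sumr mulr_suml; apply: eq_bigr => e _.
  by rewrite mulrA (X_anti a b c e) mulNr -!mulrA (X_anti a b e d) mulrN opprK.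
have YY a b c d : Y a b * Y c d = Y c d * Y a b.
  rewrite {1 4}/Y mxE mulr_sumr mulr_suml; apply: eq_bigr => e _.
  by rewrite -mulrA XY mulrA XY mulrA.
have [S [f [z [finj fz]]]] :=
  @commuting_family_lift E ('I_n * 'I_n)%type (fun p => Y p.1 p.2)
     (fun p q => YY _ _ _ _).
pose Z : 'M[S]_n := \matrix_(a, b) z (a, b).
have fZ : map_mx f Z = Y by apply/matrixP => a b; rewrite !mxE fz mxE.
have fZk k : map_mx f (Z ^+ k) = Y ^+ k.
  by elim: k => [|k IHk]; rewrite ?map_mx1 // !exprS map_mxM /= fZ IHk.
rewrite -[LHS]fZk (_ : Z ^+ n = 0) ?map_mx0 //.
apply: trace_nilpotent => [x k xk|k].
  by apply: finj; rewrite rmorph0; apply: (tfE (k := k)); rewrite -rmorphMn xk rmorph0.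
apply: finj; rewrite rmorph0 -trace_map_mx fZk.
have XYk a b c d : X a b * (Y ^+ k) c d = (Y ^+ k) c d * X a b.
  elim: k c d {fZk} => [|k IHk] c d.
    by rewrite expr0 mxE mulr_natr mulr_natl.
  rewrite exprS mxE mulr_sumr mulr_suml; apply: eq_bigr => e _.
  by rewrite mulrA XY -mulrA IHk mulrA.
pose W : 'M[E]_n := X *m Y ^+ k.
have WE : W = Y ^+ k *m X.
  rewrite /W /Y !mulmxE; elim: k {fZk XYk W} => [|k IHk]; first by rewrite mul1r mulr1.
  by rewrite exprSr mulrA IHk -!mulrA.
have XW a b c d : X a b * W c d = - (W c d * X a b).
  rewrite /W mxE mulr_sumr mulr_suml -sumrN; apply: eq_bigr => e _.
  by rewrite mulrA (X_anti a b c e) mulNr -!mulrA XYk.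
have YX : Y ^+ k.+1 = X *m W by rewrite exprS -mulmxE /Y -mulmxA.
have YW : Y ^+ k.+1 = W *m X by rewrite YX {1}WE mulmxA.
apply: (tfE (k := 1)); rewrite mulr2n {1}YX YW /mxtrace.
apply/eqP; rewrite addr_eq0; apply/eqP.
under eq_bigr do rewrite mxE; under [in RHS]eq_bigr do rewrite mxE.
rewrite exchange_big -sumrN; apply: eq_bigr => a _.
by rewrite -sumrN; apply: eq_bigr => b _; exact: XW.
Qed.
End Anticommuting.

(** * A Grassmann algebra *)

(** One anticommuting generator is adjoined at a time, inside 2 x 2 matrices
    over the previous ring: the new generator is the elementary matrix e_01, an
    old generator x becomes diag(x, -x) so as to anticommute with it, and
    scalars stay scalar.  Only the top product has to be faithful, and it sits in
    the (0, 1) entry.  Past the first m, the generators are zero; this frees the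
    anticommutation rule from any bound on the indices. *)
Lemma grassmann_exists (B : nzRingType) (m : nat) : torsion_free B ->
  exists (E : nzRingType) (iota : {rmorphism B -> E}) (e : nat -> E),
    [/\ torsion_free E,
        forall c k, iota c * e k = e k * iota c,
        forall k l, e k * e l = - (e l * e k) &
        forall c, iota c * \prod_(0 <= k < m) e k = 0 -> c = 0].
Proof.
move=> tfB; elim: m => [|m [E [iota [e [tfE ce ee top]]]]].
  exists B, idfun, (fun=> 0); split=> // [c k|k l|c]; rewrite ?(mul0r, mulr0, oppr0) //.
  by rewrite big_geq // mulr1.
pose o0 : 'I_2 := 0; pose o1 : 'I_2 := 1.
pose dg (x : E) (y : E) : 'M[E]_2 := \matrix_(i, j)
   (if i == j then if i == o0 then x else y else 0).
pose n x : 'M[E]_2 := \matrix_(i, j) (if (i == o0) && (j == o1) then x else 0).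
have dgM x y z t : dg x y * dg z t = dg (x * z) (y * t).
  apply/matrixP => i j; rewrite !mxE !big_ord_recl big_ord0 !mxE.
  by case: i => -[|[|[]]] //= ?; case: j => -[|[|[]]] //= ?; rewrite ?(mul0r, mulr0, addr0, add0r).
have nM x z t : n x * dg z t = n (x * t).
  apply/matrixP => i j; rewrite !mxE !big_ord_recl big_ord0 !mxE.
  by case: i => -[|[|[]]] //= ?; case: j => -[|[|[]]] //= ?; rewrite ?(mul0r, mulr0, addr0, add0r).
have dgn x z t : dg z t * n x = n (z * x).
  apply/matrixP => i j; rewrite !mxE !big_ord_recl big_ord0 !mxE.
  by case: i => -[|[|[]]] //= ?; case: j => -[|[|[]]] //= ?; rewrite ?(mul0r, mulr0, addr0, add0r).
have nn x y : n x * n y = 0.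
  apply/matrixP => i j; rewrite !mxE !big_ord_recl big_ord0 !mxE.
  by case: i => -[|[|[]]] //= ?; case: j => -[|[|[]]] //= ?; rewrite ?(mul0r, mulr0, addr0, add0r).
have dgN x y : - dg x y = dg (- x) (- y).
  by apply/matrixP => i j; rewrite !mxE; do ?case: ifP => _; rewrite ?oppr0.
have nN x : - n x = n (- x).
  by apply/matrixP => i j; rewrite !mxE; case: ifP => _; rewrite ?oppr0.
exists 'M[E]_2, (@scalar_mx _ 2 \o iota : {rmorphism B -> 'M[E]_2}).
have scE c : scalar_mx (iota c) = dg (iota c) (iota c).
  by apply/matrixP => i j; rewrite !mxE; case: eqP => // _; case: ifP.
exists (fun k => if k is k'.+1 then dg (e k') (- e k') else n 1); split.
- move=> x k xk; apply/matrixP => i j; rewrite [RHS]mxE; apply: (tfE _ k).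
  by have /matrixP/(_ i j) := xk; rewrite mulmxnE mxE.
- move=> c [|k] /=; rewrite scE ?dgM ?nM ?dgn ?mulr1 ?mul1r //.
  by rewrite ce mulrN ce mulNr.
- move=> [|k] [|l]; rewrite ?dgM ?nM ?dgn ?nn ?oppr0 ?nN ?dgN ?mulr1 ?mul1r ?opprK //.
  by rewrite !mulrN !mulNr !opprK -!ee.
move=> c /=; rewrite big_nat_recl //.
have [s ->] : exists s, \prod_(0 <= k < m) dg (e k) (- e k) =
   dg s ((-1) ^+ m * \prod_(0 <= k < m) e k).
  elim: {top} m => [|k [s IHk]].
    exists 1; rewrite !big_geq // mulr1; apply/matrixP => i j; rewrite !mxE.
    by case: eqP => // _; case: ifP.
  exists (s * e k); rewrite !big_nat_recr //= IHk dgM.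
  by rewrite exprS mulN1r !mulrN !mulNr mulrA.
rewrite nM mul1r scE dgn => /matrixP/(_ o0 o1); rewrite !mxE /=.
rewrite -signr_odd mulr_sign; case: ifP => _ h; apply: top => //.
by apply: oppr_inj; rewrite -mulrN h oppr0.
Qed.

(** * Combinatorics of the top form *)

(** The hypothesis is the exchange rule of products eta_j theta_i of
    anticommuting variables; it makes each transposition of the second indices
    change the sign. *)
Lemma perm_prod_sign (S : comNzRingType) (I : finType) (Z : I -> I -> S) :
  (forall i j k l, Z i j * Z k l = - (Z i l * Z k j)) ->
  forall s : {perm I}, \prod_i Z i (s i) = (-1) ^+ s * \prod_i Z i i.
Proof.
move=> Zswap s; have [ts -> tsP] := prod_tpermP s.
elim: ts tsP => [_|[x y] ts IHts /= /andP[xy {}/IHts IHts]].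
  by rewrite big_nil odd_perm1 mul1r; apply: eq_bigr => i _; rewrite perm1.
rewrite big_cons /=; set u := (\prod_(t <- ts) _)%g in IHts *.
rewrite odd_mul_tperm xy signrN mulNr -IHts.
rewrite (bigD1 x) //= (bigD1 y) 1?eq_sym //= [in RHS](bigD1 x) //=.
rewrite [in RHS](bigD1 y) 1?eq_sym //= !mulrA !permM tpermL tpermR Zswap mulNr.
congr (- (_ * _)); apply: eq_bigr => i /andP[ix iy].
by rewrite permM tpermD // eq_sym.
Qed.

(** In the expansion of the d-th power of a double sum only pairs of
    permutations survive; they are written as (t, s o t), which is the way dEt
    enumerates them. *)
Lemma sum_ffun_pair_perm (V : nmodType) (d : nat)
    (F : {ffun 'I_d -> 'I_d * 'I_d} -> V) :
  (forall (f : {ffun 'I_d -> 'I_d * 'I_d}) a b, a != b -> (f a).1 = (f b).1 \/ (f a).2 = (f b).2 -> F f = 0) ->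
  \sum_f F f =
    \sum_(s : 'S_d) \sum_(t : 'S_d) F [ffun k => (t k, s (t k))].
Proof.
move=> F0.
pose inj1 (f : {ffun 'I_d -> 'I_d * 'I_d}) := injectiveb [ffun k => (f k).1].
pose inj2 (f : {ffun 'I_d -> 'I_d * 'I_d}) := injectiveb [ffun k => (f k).2].
have F0' f : ~~ (inj1 f && inj2 f) -> F f = 0.
  rewrite negb_and => /orP[] /injectivePn[a [b ab]]; rewrite !ffunE => eab;
    apply: (F0 f a b) => //; by [left|right].
pose toperm (g : {ffun 'I_d -> 'I_d}) : 'S_d := insubd (1%g : {perm _}) g.
pose h (p : 'S_d * 'S_d) : {ffun 'I_d -> 'I_d * 'I_d} :=
  [ffun k => (p.2 k, p.1 (p.2 k))].
pose h' (f : {ffun 'I_d -> 'I_d * 'I_d}) : 'S_d * 'S_d :=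
  let t := toperm [ffun k => (f k).1] in
  (t^-1 * toperm [ffun k => (f k).2], t)%g.
have topermE (g : {ffun 'I_d -> 'I_d}) k : injectiveb g -> toperm g k = g k.
  by move=> ginj; rewrite /toperm -pvalE insubdK.
rewrite pair_big /= (bigID (fun f => inj1 f && inj2 f)) /=.
rewrite [X in _ + X]big1 ?addr0 // (reindex_onto h h') => [|f /andP[f1 f2]].
  apply: eq_big => [p|p _ //].
  have i1 : inj1 (h p).
    by apply/injectiveP => a b; rewrite !ffunE => /perm_inj.
  have i2 : inj2 (h p).
    by apply/injectiveP => a b; rewrite !ffunE => /perm_inj/perm_inj.
  rewrite i1 i2 /=; case: p i1 i2 => s t i1 i2; apply/eqP.
  have tE : toperm [ffun k => (h (s, t) k).1] = t.
    by apply/permP => k; rewrite topermE // !ffunE.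
  congr (_, _); rewrite tE //; apply/permP => k.
  by rewrite permM topermE // !ffunE /= permKV.
by apply/ffunP => k; rewrite !ffunE /= permM permK !topermE // !ffunE -surjective_pairing.
Qed.

(** * The generalized determinant of commuting matrices *)

Section ScalarExtension.
Variables (B E : nzRingType) (iota : {rmorphism B -> E}) (n : nat).

(** M (x) u in M_n(B) (x) E = M_n(E). *)
Definition mxext (M : 'M[B]_n) (u : E) : 'M[E]_n :=
  \matrix_(a, b) (iota (M a b) * u).

Lemma mxextDl (M N : 'M[B]_n) u : mxext (M + N) u = mxext M u + mxext N u.
Proof. by apply/matrixP => a b; rewrite !mxE rmorphD mulrDl. Qed.

Lemma mxextNl M u : mxext (- M) u = - mxext M u.
Proof. by apply/matrixP => a b; rewrite !mxE rmorphN mulNr. Qed.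

Lemma mxextNr M u : mxext M (- u) = - mxext M u.
Proof. by apply/matrixP => a b; rewrite !mxE mulrN. Qed.

Lemma mxext0r M : mxext M 0 = 0.
Proof. by apply/matrixP => a b; rewrite !mxE mulr0. Qed.

Lemma mxext_suml (I : finType) (F : I -> 'M[B]_n) u :
  mxext (\sum_i F i) u = \sum_i mxext (F i) u.
Proof.
apply/matrixP => a b; rewrite mxE !summxE rmorph_sum mulr_suml.
by apply: eq_bigr => i _; rewrite mxE.
Qed.

Lemma mxextM (M N : 'M[B]_n) u v : (forall c, iota c * u = u * iota c) ->
  mxext M u * mxext N v = mxext (M * N) (u * v).
Proof.
move=> cu; apply/matrixP => a b; rewrite !mxE rmorph_sum mulr_suml.
apply: eq_bigr => c _; rewrite !mxE rmorphM.
by rewrite -!mulrA; congr (_ * _); rewrite !mulrA cu.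
Qed.

Lemma mxext_prod (I : Type) (r : seq I) (M : I -> 'M[B]_n) (u : I -> E) :
  (forall i c, iota c * u i = u i * iota c) ->
  \prod_(i <- r) mxext (M i) (u i) =
    mxext (\prod_(i <- r) M i) (\prod_(i <- r) u i).
Proof.
move=> cu; elim: r => [|i r IHr].
  rewrite !big_nil; apply/matrixP => a b; rewrite !mxE mulr1.
  by rewrite rmorph_nat.
by rewrite !big_cons IHr mxextM.
Qed.

Section Anticommuting.
Variables (I J : finType) (M : I -> 'M[B]_n) (N : J -> 'M[B]_n).
Variables (u : I -> E) (v : J -> E).
Hypothesis uv : forall i j, u i * v j = - (v j * u i).
Hypothesis cu : forall i c, iota c * u i = u i * iota c.
Hypothesis cv : forall j c, iota c * v j = v j * iota c.

Lemma mxext_sum_anti a b c e :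
  (forall i j, M i a b * N j c e = N j c e * M i a b) ->
  (\sum_i mxext (M i) (u i)) a b * (\sum_j mxext (N j) (v j)) c e =
  - ((\sum_j mxext (N j) (v j)) c e * (\sum_i mxext (M i) (u i)) a b).
Proof.
move=> MN; rewrite !summxE !mulr_suml -sumrN.
under eq_bigr do rewrite mulr_sumr.
rewrite exchange_big; apply: eq_bigr => j _.
rewrite mulr_sumr -sumrN; apply: eq_bigr => i _; rewrite !mxE.
rewrite -mulrA (mulrA (u i)) -cu -mulrA uv !mulrN.
rewrite -[in RHS]mulrA (mulrA (v j)) -cv !mulrA -!rmorphM MN.
by rewrite -!mulrA.
Qed.

Lemma mxext_sumM :
  (\sum_i mxext (M i) (u i)) * (\sum_j mxext (N j) (v j)) =
  \sum_(p : I * J) mxext (M p.1 * N p.2) (u p.1 * v p.2).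
Proof.
rewrite -(pair_bigA _ (fun i j => mxext (M i * N j) (u i * v j))) /= mulr_suml.
apply: eq_bigr => i _; rewrite mulr_sumr; apply: eq_bigr => j _.
by rewrite mxextM.
Qed.
End Anticommuting.

(** The sign from exchanging u_i and u_j pairs off the terms of the square,
    because the matrices M_i and M_j commute. *)
Lemma mxext_sum_sqr (I : finType) (M : I -> 'M[B]_n) (u : I -> E) :
  torsion_free E ->
  (forall i j, u i * u j = - (u j * u i)) ->
  (forall i c, iota c * u i = u i * iota c) ->
  (forall i j, M i * M j = M j * M i) ->
  (\sum_i mxext (M i) (u i)) * (\sum_i mxext (M i) (u i)) = 0.
Proof.
move=> tfE uu cu MM; set X := (X in X * X).
have XX : X * X = - (X * X).
  rewrite /X mulr_suml; under eq_bigr do rewrite mulr_sumr.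
  rewrite [LHS]exchange_big -sumrN; apply: eq_bigr => i _.
  rewrite -sumrN; apply: eq_bigr => j _.
  by rewrite !mxextM // MM uu mxextNr.
apply/matrixP => a b; rewrite [RHS]mxE; apply: (tfE _ 1%N).
by rewrite mulr2n {1}XX mxE addNr.
Qed.

End ScalarExtension.

(** The Amitsur-Levitzki argument for X = sum_i M_i theta_i + sum_j N_j eta_j,
    whose square is the sum of the [N_j, M_i] eta_j theta_i.  The commutation of
    the entries serves to make those of X anticommute. *)
Lemma dEt_commuting_matrices (B : nzRingType) (d : nat) (M N : 'I_d -> 'M[B]_d) :
  torsion_free B ->
  (forall i j, M i * M j = M j * M i) ->
  (forall i j, N i * N j = N j * N i) ->
  (forall i j a b c e, M i a b * M j c e = M j c e * M i a b) ->
  (forall i j a b c e, N i a b * N j c e = N j c e * N i a b) ->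
  (forall i j a b c e, M i a b * N j c e = N j c e * M i a b) ->
  dEt (\matrix_(i, j) commutator (N j) (M i)) = 0.
Proof.
move=> tfB MM NN cMM cNN cMN.
have [E [iota [e [tfE ce ee top]]]] := grassmann_exists (d.*2) tfB.
(* The two kinds of generators are interleaved, so that the top product of the
   Grassmann algebra is the ordered product of the eta_i theta_i. *)
pose th (i : 'I_d) := e i.*2.+1.
pose et (i : 'I_d) := e i.*2.
have tt i j : th i * th j = - (th j * th i) by exact: ee.
have nn i j : et i * et j = - (et j * et i) by exact: ee.
have tn i j : th i * et j = - (et j * th i) by exact: ee.
have nt i j : et i * th j = - (th j * et i) by exact: ee.
have ct i c : iota c * th i = th i * iota c by exact: ce.
have cn i c : iota c * et i = et i * iota c by exact: ce.
pose XM := \sum_i mxext iota (M i) (th i).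
pose XN := \sum_i mxext iota (N i) (et i).
pose X := XM + XN.
have Xanti a b c f : X a b * X c f = - (X c f * X a b).
  rewrite mxE [X c f]mxE !mulrDl !mulrDr !opprD.
  rewrite /XM /XN !(@mxext_sum_anti _ _ _ _ _ _ _ _ _ _ _ _ _ a b) //.
  by rewrite addrACA.
have XX : X * X = \sum_(p : 'I_d * 'I_d)
    mxext iota (commutator (N p.2) (M p.1)) (et p.2 * th p.1).
  rewrite mulrDl !mulrDr /XM /XN.
  rewrite !mxext_sum_sqr // add0r addr0 !mxext_sumM //.
  rewrite [X in _ + X](reindex (fun p : 'I_d * 'I_d => (p.2, p.1))) /=; last first.
    by exists (fun p => (p.2, p.1)) => -[].
  rewrite -big_split; apply: eq_bigr => p _ /=.
  by rewrite tn mxextNr /commutator mxextDl mxextNl addrC.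
have := anticomm_mx_nilpotent tfE Xanti.
rewrite mulmxE XX => Y0.
pose z (p : 'I_d * 'I_d) := et p.2 * th p.1.
have ze p k : z p * e k = e k * z p.
  have [ne te] : et p.2 * e k = - (e k * et p.2) /\ th p.1 * e k = - (e k * th p.1).
    by split; exact: ee.
  by rewrite /z -mulrA te mulrN [in LHS]mulrA ne mulNr opprK mulrA.
have zz p q : z p * z q = z q * z p by rewrite {2 3}/z mulrA ze -mulrA ze mulrA.
have cz p c : iota c * z p = z p * iota c by rewrite mulrA ce -mulrA ce mulrA.
(* The exchange rule is applied in a commutative ring containing the
   eta_j theta_i, where products may be reindexed freely. *)
have [S [f [w [finj fw]]]] := commuting_family_lift zz.
have tfS : torsion_free S.
  by move=> x k xk; apply/finj; rewrite rmorph0; apply: (tfE _ k); rewrite -rmorphMn xk rmorph0.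
have wswap i j k l : w (i, j) * w (k, l) = - (w (i, l) * w (k, j)).
  apply: finj; rewrite rmorphN !rmorphM !fw /z /=.
  rewrite !mulrA (_ : et j * th i * et l = - (et l * th i * et j)) ?mulNr //.
  by rewrite -mulrA tn mulrN mulrA nn mulNr opprK -[in RHS]mulrA tn mulrN opprK mulrA.
have w0 (g : {ffun 'I_d -> 'I_d * 'I_d}) a b : a != b ->
    (g a).1 = (g b).1 \/ (g a).2 = (g b).2 -> \prod_k w (g k) = 0.
  move=> ab gab; rewrite (bigD1 a) //= (bigD1 b) 1?eq_sym //= mulrA.
  suff -> : w (g a) * w (g b) = 0 by rewrite mul0r.
  apply: (tfS _ 1%N); apply/eqP; rewrite mulr2n addr_eq0; apply/eqP.
  case: (g a) gab => i j; case: (g b) => k l /= [->|->]; rewrite {1}wswap //.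
  by rewrite [in LHS]mulrC.
pose W := \prod_i w (i, i).
have fW : f W = \prod_(0 <= k < d.*2) e k.
  rewrite rmorph_prod; under eq_bigr do rewrite fw.
  rewrite /z /et /th /= -(big_mkord xpredT (fun i => e i.*2 * e i.*2.+1)).
  elim: (d) => [|m IHm]; first by rewrite !big_geq.
  by rewrite doubleS big_nat_recr // IHm !(big_nat_recr _.+1) ?(big_nat_recr m.*2) //= mulrA.
pose D := dEt (\matrix_(i, j) commutator (N j) (M i)).
have : mxext iota D (f W) = 0.
  have powE (x : 'M[E]_d) : x ^+ d = \prod_(k < d) x.
    by rewrite prodr_const card_ord.
  rewrite -Y0 powE bigA_distr_bigA.
  under [RHS]eq_bigr => g _.
    rewrite mxext_prod; first over.
    by move=> k c; exact: (cz (g k) c).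
  have fwE (g : {ffun 'I_d -> 'I_d * 'I_d}) :
      \prod_k (et (g k).2 * th (g k).1) = f (\prod_k w (g k)).
    by rewrite rmorph_prod; apply: eq_bigr => k _; rewrite fw.
  rewrite sum_ffun_pair_perm => [|g a b ab gab]; last first.
    by rewrite fwE (w0 g a b) // rmorph0 mxext0r.
  rewrite /D /dEt mxext_suml; apply: eq_bigr => s _.
  rewrite mxext_suml; apply: eq_bigr => t _; rewrite fwE.
  have -> : \prod_k w ([ffun k => (t k, s (t k))] k) = (-1) ^+ s * W.
    rewrite -(perm_prod_sign (Z := fun i j => w (i, j))) //.
    rewrite [RHS](reindex_inj (@perm_inj _ t)) /=.
    by apply: eq_bigr => k _; rewrite ffunE.
  under [in RHS]eq_bigr do rewrite ffunE.
  under [in LHS]eq_bigr do rewrite mxE.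
  by rewrite rmorphM rmorph_sign !mulr_sign; case: ifP => _ //; rewrite mxextNl mxextNr.
rewrite fW => D0; apply/matrixP => a b; rewrite [RHS]mxE; apply: top.
by have /matrixP/(_ a b) := D0; rewrite !mxE.
Qed.

(** * A Cauchy estimate for polynomials *)

Lemma prim_root_exists (C : numClosedFieldType) n :
  (0 < n)%N -> exists z : C, n.-primitive_root z.
Proof.
move=> n_gt0; have [r] := closed_field_poly_normal ('X^n - 1 : {poly C}).
rewrite (monicP (monicXnsubC _ n_gt0)) scale1r => rE.
have r_unity : all n.-unity_root r.
  by apply/allP => z; rewrite -root_prod_XsubC -rE.
have r_size : (n <= size r)%N.
  by rewrite -ltnS -(size_prod_XsubC r id) -rE size_XnsubC.
have r_uniq : uniq r.
  by rewrite -separable_prod_XsubC -rE separable_Xn_sub_1 // pnatr_eq0 -lt0n.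
by have /hasP[z _ zP] := has_prim_root n_gt0 r_unity r_uniq r_size; exists z.
Qed.

Lemma sum_prim_root_expr (F : fieldType) L (z : F) k :
  L.-primitive_root z ->
  \sum_(j < L) z ^+ (j * k) = if (L %| k)%N then L%:R else 0.
Proof.
move=> zL; rewrite (prim_order_dvd zL).
under eq_bigr do rewrite mulnC exprM.
case: eqP => [->|/eqP zk1].
  by under eq_bigr do rewrite expr1n; rewrite sumr_const card_ord.
apply: (mulfI (_ : z ^+ k - 1 != 0)); first by rewrite subr_eq0.
by rewrite -subrX1 mulr0 exprAC (prim_expr_order zL) expr1n subrr.
Qed.

(** Averaging over the (m+1)-st roots of unity z^j with weights z^(-j) isolates
    the coefficient of degree one; the weight is written z^(j m) to keep the
    exponents natural. *)
Lemma norm_coef1_le (C : numClosedFieldType) (V : normedModType C) m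
    (a : nat -> V) (M : C) :
  (0 < m)%N ->
  (forall w : C, `|w| = 1 -> `|\sum_(k < m.+1) w ^+ k *: a k| <= M) ->
  `|a 1%N| <= M.
Proof.
move=> m_gt0 aM; have [z zL] := prim_root_exists C (ltn0Sn m).
have z1 : `|z| = 1.
  apply/eqP; rewrite -(@pexpr_eq1 _ _ m.+1) //.
  by rewrite -normrX (prim_expr_order zL) normr1.
have a1E : m.+1%:R *: a 1%N =
    \sum_(j < m.+1) z ^+ (j * m) *: \sum_(k < m.+1) (z ^+ j) ^+ k *: a k.
  under eq_bigr do rewrite scaler_sumr.
  rewrite exchange_big /=.
  have i1 : (1 < m.+1)%N by [].
  rewrite (bigD1 (Ordinal i1)) //= [X in _ + X]big1 ?addr0 => [|k k1].
     under eq_bigr do rewrite scalerA -exprM -exprD -mulnDr addn1.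
    by rewrite -scaler_suml sum_prim_root_expr // dvdnn.
  under eq_bigr do rewrite scalerA -exprM -exprD -mulnDr.
  rewrite -scaler_suml sum_prim_root_expr // ifN ?scale0r //.
  apply: contra k1 => /dvdnP[q mk]; apply/eqP/val_inj => /=.
  case: q mk => [|[|q]] mk; first by have := m_gt0; lia.
    by lia.
  have := ltn_ord k; move: mk; rewrite !mulSn; lia.
rewrite -(ler_pM2l (ltr0Sn C m)) -normr_nat -normrZ a1E normr_nat.
apply: le_trans (ler_norm_sum _ _ _) _.
have -> : m.+1%:R * M = \sum_(j < m.+1) M by rewrite sumr_const card_ord mulr_natl.
apply: ler_sum => j _.
rewrite normrZ normrX z1 expr1n mul1r; apply: aM.
by rewrite normrX z1 expr1n.
Qed.

(** * Fuglede's theorem *)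

Section Adjoint.
Variables (R : realType) (H : hilbertType R).
Implicit Types S T N X K : bop H.

Lemma adjPl T x y : hdot (adj T x) y = hdot x (T y).
Proof. by rewrite hdotC -adjP -hdotC. Qed.

Lemma adj_adj T : adj (adj T) = T.
Proof. by apply: bopP => y; apply: hdot_injr => x; rewrite -adjP adjPl. Qed.

Lemma adjM S T : adj (S * T) = adj T * adj S.
Proof. by apply: bopP => y; apply: hdot_injr => x; rewrite -adjP !bopME !adjP. Qed.

Definition skew_bounded K (k : R) :=
  (forall x y, hdot (K x) y = - hdot x (K y)) /\
  (forall x, rnorm (K x) <= k * rnorm x).

(** Pythagoras: <x, K x> is purely imaginary when K is skew-adjoint. *)
Lemma rnorm_addKx K k x : skew_bounded K k ->
  rnorm ((1 + K) x) ^+ 2 <= (1 + k ^+ 2) * rnorm x ^+ 2.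
Proof.
case=> skew Kk; have -> : rnorm ((1 + K) x) ^+ 2 = rnorm x ^+ 2 + rnorm (K x) ^+ 2.
  apply: (@complexI R); rewrite [RHS]rmorphD /= !rnorm2.
  by rewrite hdotDl !hdotDr (skew x x); ring.
rewrite mulrDl mul1r lerD2l -exprMn ler_sqr ?nnegrE ?rnorm_ge0 //.
by apply: le_trans (Kk x); exact: rnorm_ge0.
Qed.

(** X + [K, X] = (1 + K) X (1 - K) + K X K, and both 1 + K and 1 - K have norm at
    most sqrt (1 + k^2); the terms of first order in k have disappeared. *)
Lemma opnorm_skew_commutator K X (k : R) : skew_bounded K k ->
  opnorm (X + (K * X - X * K)) <= (1 + 2 * k ^+ 2) * opnorm X.
Proof.
move=> Kk; have [skew bnd] := Kk.
have NKk : skew_bounded (- K) k.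
  split=> x => [y|]; first by rewrite !bopNE hdotNl hdotNr skew.
  by rewrite bopNE /rnorm normrN; exact: bnd.
have k2 := sqr_ge0 k; have X0 := opnorm_ge0 X.
have -> : X + (K * X - X * K) = (1 + K) * X * (1 + - K) + K * X * K.
  by rewrite mulrBr mulr1 !mulrDl mul1r opprD !addrA subrK.
have kX0 : 0 <= k ^+ 2 * opnorm X by exact: mulr_ge0.
have kX1 : 0 <= (1 + k ^+ 2) * opnorm X by apply: mulr_ge0 => //; exact: addr_ge0.
apply: opnorm_le => x x1; rewrite bopDE.
apply: le_trans (rnormD _ _) _.
have x2 : rnorm x ^+ 2 <= 1 by rewrite exprn_ile1 ?rnorm_ge0.
have -> : (1 + 2 * k ^+ 2) * opnorm X = (1 + k ^+ 2) * opnorm X + k ^+ 2 * opnorm X by ring.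
apply: lerD.
  rewrite -ler_sqr ?nnegrE ?rnorm_ge0 // !bopME.
  apply: le_trans (rnorm_addKx _ Kk) _.
  set u := (1 + - K) x.
  have h1 : rnorm u ^+ 2 <= 1 + k ^+ 2.
    by apply: le_trans (rnorm_addKx _ NKk) _; rewrite ler_piMr // addr_ge0.
  have h2 : rnorm (X u) ^+ 2 <= opnorm X ^+ 2 * rnorm u ^+ 2.
    by rewrite -exprMn ler_sqr ?nnegrE ?rnorm_ge0 ?mulr_ge0 ?rnorm_ge0 ?le_opnorm.
  have -> : ((1 + k ^+ 2) * opnorm X) ^+ 2 = (1 + k ^+ 2) * (opnorm X ^+ 2 * (1 + k ^+ 2)) by ring.
  rewrite ler_wpM2l ?addr_ge0 //; apply: le_trans h2 _.
  by rewrite ler_wpM2l // sqr_ge0.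
rewrite !bopME.
rewrite -ler_sqr ?nnegrE ?rnorm_ge0 //.
have b2 y : rnorm (K y) ^+ 2 <= k ^+ 2 * rnorm y ^+ 2.
  rewrite -exprMn ler_sqr ?nnegrE ?rnorm_ge0 ?bnd //.
  by apply: le_trans (bnd y); exact: rnorm_ge0.
apply: le_trans (b2 _) _.
have -> : (k ^+ 2 * opnorm X) ^+ 2 = k ^+ 2 * (opnorm X ^+ 2 * k ^+ 2) by ring.
rewrite ler_wpM2l //.
have : rnorm (X (K x)) ^+ 2 <= opnorm X ^+ 2 * rnorm (K x) ^+ 2.
  by rewrite -exprMn ler_sqr ?nnegrE ?rnorm_ge0 ?mulr_ge0 ?rnorm_ge0 ?le_opnorm.
move=> h; apply: le_trans h _; rewrite ler_wpM2l ?sqr_ge0 //.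
by apply: le_trans (b2 _) _; rewrite ler_piMr.
Qed.

End Adjoint.

(** The binomial expansion of (1 + t D)^m applied to x. *)
Lemma iter_add_scale (K : comNzRingType) (V : lmodType K) (D : {additive V -> V})
    (t : K) (x : V) m :
  (forall y, D (t *: y) = t *: D y) ->
  iter m (fun y => y + t *: D y) x =
    \sum_(k < m.+1) t ^+ k *: (iter k D x *+ 'C(m, k)).
Proof.
move=> Dt; have Dtk k y : D (t ^+ k *: y) = t ^+ k *: D y.
  by elim: k => [|k IHk]; rewrite ?expr0 ?scale1r // exprS -!scalerA Dt IHk.
elim: m => [|m IHm] /=; first by rewrite big_ord1 expr0 scale1r bin0 mulr1n.
rewrite IHm raddf_sum /= scaler_sumr.
rewrite [in RHS]big_ord_recl [X in X + _ = _]big_ord_recl /= !bin0 -addrA.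
congr (_ + _).
under [X in _ + X]eq_bigr do rewrite Dtk raddfMn /= scalerA -exprS.
under [RHS]eq_bigr => k _.
  rewrite /bump /= add1n binS mulrnDr scalerDr; over.
rewrite big_split /=; congr (_ + _).
rewrite [RHS]big_ord_recr /= bin_small // mulr0n scaler0 addr0.
by apply: eq_bigr => k _; rewrite /bump add1n.
Qed.

Section Fuglede.
Variables (R : realType) (H : hilbertType R) (N : bop H).
Implicit Types X Y : bop H.
Hypothesis N_normal : N * adj N = adj N * N.

(* D is the derivation whose vanishing on the commutant of N is to be shown. *)
Let D Y := adj N * Y - Y * adj N.

Fact D_additive : zmod_morphism D.
Proof.
move=> X Y; rewrite /D mulrBr mulrBl !opprB addrACA [RHS]addrACA.
by congr (_ + _); rewrite addrC.
Qed.
HB.instance Definition _ := GRing.isZmodMorphism.Build (bop H) (bop H) D D_additive.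

Lemma bop_scaleAl (a : R[i]) X Y : (a *: X) * Y = a *: (X * Y).
Proof. exact: bopP. Qed.

Lemma bop_scaleAr (a : R[i]) X Y : X * (a *: Y) = a *: (X * Y).
Proof. by apply: bopP => x /=; rewrite linearZ. Qed.

Lemma D_scale t Y : D (t *: Y) = t *: D Y.
Proof. by rewrite /D bop_scaleAl bop_scaleAr scalerBr. Qed.

Lemma D_comm Y : Y * N = N * Y -> D Y * N = N * D Y.
Proof.
move=> YN; rewrite /D mulrBl mulrBr -!mulrA YN -N_normal.
by rewrite !mulrA YN N_normal.
Qed.

Lemma skew_bounded_normal (t : R[i]) :
  skew_bounded (t *: adj N - Num.conj t *: N)
    (complex.Re `|t| * (opnorm N + opnorm (adj N))).
Proof.
split=> x => [y|].
  rewrite !bopDE !bopNE !bopZE hdotBl hdotBr !hdotZl !hdotZr adjPl adjP conjCK; ring.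
rewrite bopDE bopNE !bopZE.
apply: le_trans (rnormD _ _) _; rewrite {2}/rnorm normrN -/(rnorm _) !rnormZ norm_conjC.
rewrite -mulrDr -mulrA ler_wpM2l //.
  by rewrite -ler0c RRe_real ?normr_real.
by rewrite addrC mulrDl lerD // le_opnorm.
Qed.

(** Since Y commutes with N, subtracting conj(t) N from t N^* does not change the
    commutator with Y but makes the operator skew-adjoint. *)
Lemma opnorm_D_step (t : R[i]) Y : Y * N = N * Y ->
  opnorm (Y + t *: D Y) <=
    (1 + 2 * (complex.Re `|t| * (opnorm N + opnorm (adj N))) ^+ 2) * opnorm Y.
Proof.
move=> YN; have := opnorm_skew_commutator Y (skew_bounded_normal t).
rewrite (_ : _ * Y - Y * _ = t *: D Y) //.
rewrite mulrBl mulrBr !bop_scaleAl !bop_scaleAr YN scalerBr.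
by rewrite opprB addrA subrK.
Qed.

(** The polynomial w |-> (1 + (w/n) D)^(n^2) X is bounded on the unit circle by
    (1 + 2 c^2 / n^2)^(n^2) |X| <= exp (2 c^2) |X|, independently of n, while
    its coefficient of degree one is n D X. *)
Theorem fuglede X : X * N = N * X -> X * adj N = adj N * X.
Proof.
move=> XN; suff DX0 : D X = 0 by apply/esym/eqP; rewrite -subr_eq0 -/(D X) DX0.
set c := opnorm N + opnorm (adj N).
pose M := expR (2 * c ^+ 2) * opnorm X.
have DXn n : (0 < n)%N -> opnorm (D X) *+ n <= M.
  move=> n_gt0; pose m := (n ^ 2)%N.
  have m_gt0 : (0 < m)%N by rewrite expn_gt0 n_gt0.
  have n0 : (n%:R : R[i]) != 0 by rewrite pnatr_eq0 -lt0n.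
  pose a k := n%:R^-1 ^+ k *: (iter k D X *+ 'C(m, k)) : bop H.
  have a1 : a 1%N = D X *+ n.
    by rewrite /a expr1 bin1 -[_ *+ m]scaler_nat scalerA natrX expr2 mulKf // scaler_nat.
  have := @norm_coef1_le _ _ m a M%:C m_gt0.
  rewrite a1 => hM.
  suff : `|D X *+ n| <= M%:C.
    rewrite normrMn => h; rewrite -lecR rmorphMn; exact: h.
  apply: hM => w w1.
  have -> : \sum_(k < m.+1) w ^+ k *: a k =
      iter m (fun Y => Y + (w / n%:R) *: D Y) X.
    rewrite (iter_add_scale _ _ (D_scale _)); apply: eq_bigr => k _.
    by rewrite /a scalerA -exprMn.
  have wn : complex.Re `|w / n%:R| = n%:R^-1.
    rewrite normrM w1 mul1r normfV normr_nat.
    by rewrite -(rmorph_nat (real_complex R)) -fmorphV.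
  have : forall k, let Y := iter k (fun Y => Y + (w / n%:R) *: D Y) X in
      Y * N = N * Y /\ opnorm Y <= (1 + 2 * (n%:R^-1 * c) ^+ 2) ^+ k * opnorm X.
    elim=> [|k /= [IH1 IH2]]; first by rewrite mul1r.
    split.
      by rewrite mulrDl mulrDr bop_scaleAl bop_scaleAr IH1 D_comm.
    apply: le_trans (opnorm_D_step _ IH1) _.
    rewrite wn -/c [_ ^+ k.+1]exprS -[leRHS]mulrA; apply: ler_wpM2l => //.
    by rewrite addr_ge0 // mulr_ge0 // sqr_ge0.
  move=> /(_ m)[_ h]; rewrite lecR; apply: le_trans h _.
  rewrite /M ler_wpM2r ?opnorm_ge0 //.
  have -> : 2 * (n%:R^-1 * c) ^+ 2 = 2 * c ^+ 2 / m%:R.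
    by rewrite /m natrX exprMn exprVn; ring.
  have -> : expR (2 * c ^+ 2) = expR (2 * c ^+ 2 / m%:R) ^+ m.
    by rewrite -expRM_natl [m%:R * _]mulrC divfK // pnatr_eq0 -lt0n.
  rewrite lerXn2r ?nnegrE ?expR_ge0 ?expR_ge1Dx //.
  by rewrite addr_ge0 // mulr_ge0 // mulr_ge0 // sqr_ge0.
apply: bop_norm0_eq0; rewrite /bop_norm; congr (_%:C); apply/eqP.
rewrite eq_le opnorm_ge0 andbT leNgt; apply/negP => D0.
have M0 : 0 <= M by rewrite mulr_ge0 ?expR_ge0 ?opnorm_ge0.
have := DXn (Num.truncn (M / opnorm (D X))).+1 isT.
rewrite leNgt => /negP; apply.
by rewrite -mulr_natl -ltr_pdivrMr // truncnS_gt.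
Qed.
End Fuglede.

(** * The C*-algebra generated by commuting normal operators *)

Section Commutant.
Variables (R : realType) (H : hilbertType R).
Implicit Types S T X : bop H.

Definition commutant (M : set (bop H)) : set (bop H) :=
  [set S | forall X, M X -> S * X = X * S].

Lemma opnormM S T : opnorm (S * T) <= opnorm S * opnorm T.
Proof.
apply: opnorm_le => x x1; apply: le_trans (le_opnorm S (T x)) _.
rewrite ler_wpM2l ?opnorm_ge0 //; apply: le_trans (le_opnorm T x) _.
by rewrite ler_piMr ?opnorm_ge0.
Qed.

Lemma closed_commutant (M : set (bop H)) : closed (commutant M).
Proof.
move=> S clS X MX; apply/eqP; rewrite -subr_eq0; apply/eqP.
apply: bop_norm0_eq0; rewrite /bop_norm; congr (_%:C); apply/eqP.
rewrite eq_le opnorm_ge0 andbT; apply/ler_addgt0Pr => e e0; rewrite add0r.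
pose r := e / (2 * opnorm X + 1).
have d0 : 0 < 2 * opnorm X + 1 by rewrite ltr_wpDl // mulr_ge0 // opnorm_ge0.
have r0 : 0 < r by rewrite divr_gt0.
have [T [TM]] := clS _ (@nbhsx_ballx _ (bop H) S r%:C ltac:(by rewrite ltcR)).
rewrite -ball_normE /= ltcR => ST.
have -> : S * X - X * S = (S - T) * X - X * (S - T).
  by rewrite mulrBl mulrBr (TM X MX) opprB addrA subrK.
apply: le_trans (_ : opnorm ((S - T) * X) + opnorm (X * (S - T)) <= _).
  have := @ler_normB _ (bop H) ((S - T) * X) (X * (S - T)).
  by rewrite -(rmorphD (real_complex R)) lecR.
apply: le_trans (_ : r * opnorm X + opnorm X * r <= _).
  apply: lerD; apply: le_trans (opnormM _ _) _.
    by rewrite ler_wpM2r ?opnorm_ge0 // ltW.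
  by rewrite ler_wpM2l ?opnorm_ge0 // ltW.
have <- : r * (2 * opnorm X + 1) = e by rewrite divfK // gt_eqF.
nra.
Qed.

Lemma cstar_algebra_commutant (M : set (bop H)) :
  (forall X, M X -> M (adj X)) -> cstar_algebra (commutant M).
Proof.
move=> adjM_; split; last exact: closed_commutant.
split=> [X MX|S T cS cT X MX|a S cS X MX|S T cS cT X MX|S cS X MX].
- by rewrite mul0r mulr0.
- by rewrite mulrDl mulrDr cS // cT.
- by rewrite bop_scaleAl bop_scaleAr cS.
- by rewrite -mulrA cT // mulrA cS // mulrA.
- by rewrite -[X]adj_adj -!adjM (cS (adj X)) //; exact: adjM_.
Qed.

(** Take for A the commutant of the N_k and their adjoints.  By Fuglede's theorem
    it contains the N_k, and the commutant of A contains them as well; being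
    C*-algebras, both contain the generated one, whose elements therefore commute
    with one another. *)
Lemma cstar_gen_commutants (d : nat) (N : 'I_d -> bop H) :
  commuting N -> (forall k, N k * adj (N k) = adj (N k) * N k) ->
  exists A : set (bop H), [/\ cstar_algebra A, cstar_algebra (commutant A),
    cstar_gen N `<=` A & cstar_gen N `<=` commutant A].
Proof.
move=> NC Nn.
pose G : set (bop H) := [set X | exists k, X = N k \/ X = adj (N k)].
have adjG X : G X -> G (adj X).
  by move=> [k [->|->]]; exists k; [right|left; rewrite adj_adj].
have cA := cstar_algebra_commutant adjG.
have cA' : cstar_algebra (commutant (commutant G)).
  by apply: cstar_algebra_commutant; case: cA => -[].
exists (commutant G); split => //; apply: smallest_sub => // _ [k _ <-].
  by move=> X [j [->|->]] //; exact: fuglede.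
by move=> X cX; apply/esym/cX; exists k; left.
Qed.

Lemma tensor_mx_entries n (A C : set (bop H)) (X : 'M[bop H]_n) i j :
  cstar_algebra A -> C `<=` A -> tensor_mx n C X -> A (X i j).
Proof.
move=> [[A0 AD AZ _ _] _] CA [r [a [m [Ca ->]]]].
rewrite summxE; elim/big_ind: _ => // k _; rewrite mxE.
by apply: AZ; exact: CA.
Qed.

Lemma bop_torsion_free : torsion_free (bop H).
Proof.
move=> S k Sk; have : k.+1%:R *: S = 0 :> bop H by rewrite scaler_nat.
by move=> /eqP; rewrite scaler_eq0 pnatr_eq0 => /eqP.
Qed.
End Commutant.

(** * The theorem *)

(** A C*-algebra of operators need not contain the identity and phi is only
    controlled on A, so that the products in dEt must be nonempty: hence the
    hypothesis on d. *)
Lemma dEt_morph (A1 A2 : pzRingType) (A : set A1) (phi : A1 -> A2) (d : nat)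
    (B : 'M[A1]_d) : (0 < d)%N ->
  A 0 -> phi 0 = 0 ->
  (forall x y, A x -> A y -> A (x + y) /\ phi (x + y) = phi x + phi y) ->
  (forall x, A x -> A (- x) /\ phi (- x) = - phi x) ->
  (forall x y, A x -> A y -> A (x * y) /\ phi (x * y) = phi x * phi y) ->
  (forall i j, A (B i j)) ->
  A (dEt B) /\ phi (dEt B) = dEt (map_mx phi B).
Proof.
move=> d_gt0 A0 phi0 AD AN AM AB.
have sumP (I : finType) (F : I -> A1) (G : I -> A2) :
    (forall i, A (F i) /\ phi (F i) = G i) ->
    A (\sum_i F i) /\ phi (\sum_i F i) = \sum_i G i.
  move=> FG; elim/big_rec2: _ => [|i y x _ [Ax <-]]; first by [].
  by have [AF <-] := FG i; exact: AD.
have prodP (F : 'I_d -> A1) : (forall i, A (F i)) ->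
    A (\prod_i F i) /\ phi (\prod_i F i) = \prod_i phi (F i).
  move=> AF; case: (index_enum _) (mem_index_enum (Ordinal d_gt0)) => // i s _.
  elim: s i => [|j s IHs] i; first by rewrite !big_seq1.
  rewrite big_cons [in RHS]big_cons; have [As <-] := IHs j.
  exact: AM.
rewrite /dEt; apply: (sumP) => s; apply: (sumP) => t.
have [Ap phip] := prodP (fun i => B (t i) (s (t i))) (fun i => AB _ _).
under [\prod_(_ < _) map_mx _ _ _ _]eq_bigr do rewrite mxE.
rewrite -phip !mulr_sign; case: (odd_perm s) => //.
exact: AN.
Qed.

Theorem corollary3p6 (R : realType) (H : hilbertType R) (hsep : separable H)
    (d : nat) (d_gt0 : (0 < d)%N) (T : 'I_d -> bop H)
    (T_comm : commuting T) (T_normal : n_normal d T) :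
  dEt (self_commutator_mx T) = 0.
Proof.
have [_ [A [K [N [cA AT NC Nn [phi [phi_bij phiL phiM phi_adj _]]]]]]] := T_normal.
have [[A0 AD AZ AM Aadj] _] := cA.
have phiD S1 S2 : A S1 -> A S2 -> A (S1 + S2) /\ phi (S1 + S2) = phi S1 + phi S2.
  move=> A1 A2; split; first exact: AD.
  rewrite -[S1 in LHS]scale1r phiL //; congr (_ + _).
  by apply/matrixP => i j; rewrite mxE scale1r.
have phi0 : phi 0 = 0.
  have := (phiD 0 0 A0 A0).2; rewrite addr0 => /esym/eqP.
  by rewrite -[eqbRHS]addr0 (inj_eq (addrI _)) => /eqP.
have phiN S : A S -> A (- S) /\ phi (- S) = - phi S.
  move=> AS; rewrite -scaleN1r; split; first exact: AZ.
  rewrite -[_ *: _]addr0 phiL // phi0 addr0.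
  by apply/matrixP => i j; rewrite !mxE scaleN1r.
have phiM' S1 S2 : A S1 -> A S2 -> A (S1 * S2) /\ phi (S1 * S2) = phi S1 * phi S2.
  by move=> A1 A2; split; [exact: AM|exact: phiM].
have AB i j : A (self_commutator_mx T i j).
  rewrite mxE /commutator; apply: AD; first by apply: AM => //; exact: Aadj.
  by apply: (phiN _ _).1; apply: AM => //; exact: Aadj.
have [AdEt phi_dEt] := dEt_morph d_gt0 A0 phi0 phiD phiN phiM' AB.
have [phi_fun phi_inj _] := phi_bij.
apply: phi_inj; rewrite ?inE // phi_dEt phi0.
have AaT k : A (adj (T k)) by exact: Aadj.
have -> : map_mx phi (self_commutator_mx T) =
    \matrix_(i, j) commutator (phi (adj (T j))) (phi (T i)).
  apply/matrixP => i j; rewrite !mxE /commutator.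
  have [A1 <-] := phiM' _ _ (AaT j) (AT i).
  have [A2 <-] := phiM' _ _ (AT i) (AaT j).
  by have [A3 <-] := phiN _ A2; have [] := phiD _ _ A1 A3.
have [C [cC cC' NC1 NC2]] := cstar_gen_commutants NC Nn.
have entryC S1 S2 a b c e : A S1 -> A S2 ->
    phi S1 a b * phi S2 c e = phi S2 c e * phi S1 a b.
  move=> A1 A2; have X1 := phi_fun _ A1; have X2 := phi_fun _ A2.
  have := tensor_mx_entries c e cC' NC2 X2.
  by move=> /(_ _ (tensor_mx_entries a b cC NC1 X1)) ->.
have TT i j : phi (T i) * phi (T j) = phi (T j) * phi (T i).
  by rewrite -(phiM' _ _ _ _).2 // T_comm (phiM' _ _ _ _).2.
have aTaT i j : phi (adj (T i)) * phi (adj (T j)) = phi (adj (T j)) * phi (adj (T i)).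
  by rewrite -(phiM' _ _ _ _).2 // -adjM T_comm adjM (phiM' _ _ _ _).2.
(* Over the zero space, all operator matrices coincide. *)
have [K0|K1] := eqVneq (1 : bop K) 0.
  by apply/matrixP => i j; rewrite -[LHS]mul1r -[RHS]mul1r K0 !mul0r.
pose B : nzRingType := HB.pack (bop K)
  (GRing.PzSemiRing_isNonZero.Build (bop K) K1).
apply: (@dEt_commuting_matrices B d (fun i => phi (T i)) (fun i => phi (adj (T i)))).
- exact: bop_torsion_free.
- exact: TT.
- exact: aTaT.
- by move=> i j a b c e; exact: entryC.
- by move=> i j a b c e; exact: entryC.
- by move=> i j a b c e; exact: entryC.
Qed.
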